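(* For every positive integer $n$, $$A(n) = n - 2^k\, \tau\!\left(\frac{n+1}{2^k} - 1\right),$$ where $k=\lfloor\log_2(n)\rfloor$.
   Context: For a positive integer $i$, let $d_1(i)$ and $d_0(i)$ denote the number of digits $1$ and the number of digits $0$, respectively, in the binary expansion of $i$ (without leading zeros). For every nonnegative integer $n$, set $A(n)=\sum_{i=1}^{n}\bigl(d_1(i)-d_0(i)\bigr)$, so that $A(0)=0$ (this is the OEIS sequence A268289). The Takagi function is $\tau(x)=\sum_{j=0}^{\infty} 2^{-j}\,\operatorname{dist}(2^j x,\mathbb{Z})$, where $\operatorname{dist}(y,\mathbb{Z})$ is the distance from $y$ to the nearest integer. *)

(* Defs.v *)
From HB Require Import structures.
From mathcomp Require Import all_boot all_order all_algebra.
From mathcomp Require Import all_classical all_reals all_analysis.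
Set Implicit Arguments.
Unset Strict Implicit.
Unset Printing Implicit Defensive.
Import Order.TTheory GRing.Theory Num.Theory.
Import numFieldNormedType.Exports.
Local Open Scope classical_set_scope.
Local Open Scope ring_scope.

(** For [i > 0] the binary expansion without leading zeros has
    [trunc_log 2 i + 1] digits; they are listed least significant first, with
    [true] for the digit 1.  At [i = 0] the list is [[:: false]], a value that
    [A] never uses. *)
Definition binary_digits (i : nat) : seq bool :=
  mkseq (fun j => odd (i %/ 2 ^ j)%N) (trunc_log 2 i).+1.

Definition d1 (i : nat) : nat := count_mem true (binary_digits i).
Definition d0 (i : nat) : nat := count_mem false (binary_digits i).

Definition A (n : nat) : int := \sum_(1 <= i < n.+1) ((d1 i)%:Z - (d0 i)%:Z).

Definition dist_int (R : realType) (y : R) : R :=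
  inf [set `|y - m%:~R| | m in [set: int]].

(** The terms lie in [[0, 2 ^- j / 2]], so the limit exists for every [x]. *)
Definition takagi (R : realType) (x : R) : R :=
  limn (series (fun j : nat => 2 ^- j * dist_int (2 ^+ j * x) : R)).

(* Main.v *)
Require Import Defs.
From HB Require Import structures.
From mathcomp Require Import all_boot all_order all_algebra.
From mathcomp Require Import all_classical all_reals all_analysis.
From mathcomp Require Import zify ring lra.
Import Order.TTheory GRing.Theory Num.Theory.
Import numFieldNormedType.Exports.
Local Open Scope ring_scope.

(** At a dyadic argument the Takagi series is a finite sum of integers up to
    scaling.  Writing [D d m] for the distance from [m] to the nearest multiple
    of [d], one has [dist (m / d, Z) = D d m / d], and the terms of index
    [j >= K] of the series at [m / 2 ^ K] vanish, so [takagi_dyadic]: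
    [2 ^ K * takagi (m / 2 ^ K)] is the sum of [D (2 ^ i) m] for [1 <= i <= K].

    That sum counts binary digits incrementally.  As [m] grows by one,
    [D (2 ^ i) m] goes up by 1 on the first half of each period of length
    [2 ^ i] and down by 1 on the second half, and the half is read off from the
    digit of weight [2 ^ (i - 1)] of [m]: [dist_multiple_succ].  Hence the sum
    changes by the number of zeros minus the number of ones among the [K] low
    digits of [m].  If [K] is the position of the leading 1 of [m], this is
    [1 - (d1 m - d0 m)], so an induction gives [A_multiple_deviation]: [A n] is
    [n] minus the sum at [n + 1].  When [n] reaches a new power of 2 a term is
    added to the sum, but all its terms vanish at [n].

    Finally [n + 1] may be replaced by [n + 1 - 2 ^ K], the numerator of the
    argument of the Takagi function, since each [D (2 ^ i)] with [i <= K] has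
    period dividing [2 ^ K]. *)

Definition dist_multiple (d m : nat) : nat := minn (m %% d) (d - m %% d).

Lemma dist_multiple_dvd (d m : nat) : (d %| m)%N -> dist_multiple d m = 0%N.
Proof. by rewrite /dist_multiple => /eqP ->; rewrite min0n. Qed.

Lemma dist_multiple_mod (d m m' : nat) :
  m = m' %[mod d] -> dist_multiple d m = dist_multiple d m'.
Proof. by rewrite /dist_multiple => ->. Qed.

(** The parity of [m %/ e] is a digit when [e] is a power of 2; it tells in
    which half of its period of length [2 e] the number [m] lies. *)
Lemma odd_div_half (e m : nat) :
  (0 < e)%N -> odd (m %/ e) = (e <= m %% e.*2)%N.
Proof.
move=> e_gt0; have e2_gt0 : (0 < e.*2)%N by rewrite double_gt0.
have s_lt := ltn_pmod m e2_gt0.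
rewrite {1}(divn_eq m e.*2) -mul2n mulnA divnMDl // mul2n oddD oddM /= andbF /=.
have [s_lt_e|e_le_s] := ltnP (m %% e.*2) e; first by rewrite divn_small.
suff -> : ((m %% e.*2) %/ e = 1)%N by [].
by apply/eqP; rewrite eqn_leq leq_divRL // mul1n e_le_s -ltnS ltn_divLR // mul2n s_lt.
Qed.

(** The distance to the multiples of [2 e] is a triangular wave, with slope 1 on
    the first half of each period and slope -1 on the second. *)
Lemma dist_multiple_succ (e m : nat) : (0 < e)%N ->
  (dist_multiple e.*2 m.+1)%:Z
    = (dist_multiple e.*2 m)%:Z - (if odd (m %/ e) then 1 else - 1).
Proof.
move=> e_gt0; rewrite odd_div_half // /dist_multiple.
have s_lt : (m %% e.*2 < e.*2)%N by rewrite ltn_pmod // double_gt0.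
rewrite -addn1 -modnDml addn1.
have [s1_lt|s1_ge] := ltnP (m %% e.*2).+1 e.*2.
  by rewrite modn_small //; case: ifP => /=; lia.
have -> : (m %% e.*2).+1 = e.*2 by lia.
by rewrite modnn; case: ifP => /=; lia.
Qed.

Lemma count_mem_bool_sub (s : seq bool) :
  (count_mem true s)%:Z - (count_mem false s)%:Z
    = \sum_(b <- s) (if b then 1 else - 1).
Proof.
elim: s => [|b s IHs]; first by rewrite big_nil.
by rewrite big_cons -IHs; case: b => /=; lia.
Qed.

Lemma odd_top_digit (n : nat) :
  (0 < n)%N -> odd (n %/ 2 ^ trunc_log 2 n).
Proof.
move=> n_gt0; have /andP[le_n lt_n] := trunc_log_bounds (isT : 1 < 2)%N n_gt0.
suff -> : (n %/ 2 ^ trunc_log 2 n = 1)%N by [].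
by apply/eqP; rewrite eqn_leq leq_divRL ?expn_gt0 // mul1n le_n -ltnS
  ltn_divLR ?expn_gt0 // -expnS lt_n.
Qed.

(** The leading digit is a 1, and contributes the isolated term; only the lower
    digits match slopes of the triangular waves. *)
Lemma digit_excess (n : nat) : (0 < n)%N ->
  (d1 n)%:Z - (d0 n)%:Z
    = 1 + \sum_(j < trunc_log 2 n) (if odd (n %/ 2 ^ j) then 1 else - 1).
Proof.
move=> n_gt0; rewrite /d1 /d0 count_mem_bool_sub /binary_digits /mkseq big_map.
by rewrite -[X in iota 0 X]subn0 -/(index_iota 0 _) big_mkord big_ord_recr /= odd_top_digit // addrC.
Qed.

(** This is [2 ^ K] times the value at [m / 2 ^ K] of the Takagi function; see
    [takagi_dyadic]. *)
Definition multiple_deviation (K m : nat) : nat :=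
  \sum_(i < K) dist_multiple (2 ^ i.+1) m.

Lemma multiple_deviation_succ (K m : nat) :
  (multiple_deviation K m.+1)%:Z = (multiple_deviation K m)%:Z
    - \sum_(j < K) (if odd (m %/ 2 ^ j) then 1 else - 1).
Proof.
rewrite /multiple_deviation !(big_morph Posz PoszD erefl) -sumrB; apply: eq_bigr => i _.
by rewrite expnS mul2n dist_multiple_succ // expn_gt0.
Qed.

Lemma multiple_deviation_pow2 (K L : nat) :
  (K <= L)%N -> multiple_deviation K (2 ^ L) = 0%N.
Proof.
move=> le_KL; apply: big1 => i _.
by rewrite dist_multiple_dvd // dvdn_exp2l // (leq_trans _ le_KL).
Qed.

(** The number of terms jumps only when [n.+1] is a power of 2, and then it is a
    multiple of all the moduli involved.  This lets the induction for [A]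
    proceed uniformly across powers of 2. *)
Lemma multiple_deviation_trunc_log_succ (n : nat) :
  multiple_deviation (trunc_log 2 n.+1) n.+1
    = multiple_deviation (trunc_log 2 n) n.+1.
Proof.
have le_nn1 : (trunc_log 2 n <= trunc_log 2 n.+1)%N by exact: leq_trunc_log.
have [lt_log|ge_log] := ltnP (trunc_log 2 n) (trunc_log 2 n.+1); last first.
  by congr multiple_deviation; apply/eqP; rewrite eqn_leq ge_log.
have n1_pow2 : n.+1 = (2 ^ trunc_log 2 n.+1)%N.
  apply/eqP; rewrite eqn_leq trunc_logP // andbT.
  apply: leq_trans (trunc_log_ltn n (isT : 1 < 2)%N) _.
  by rewrite leq_exp2l.
by rewrite [X in multiple_deviation _ X]n1_pow2 [X in _ = multiple_deviation _ X]n1_pow2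
  !multiple_deviation_pow2.
Qed.

Lemma A_multiple_deviation (n : nat) :
  A n = n%:Z - (multiple_deviation (trunc_log 2 n) n.+1)%:Z.
Proof.
elim: n => [|n IHn].
  by rewrite /A big_geq // /multiple_deviation trunc_log0 big_ord0.
rewrite /A big_nat_recr //= -/(A n) IHn digit_excess //.
rewrite (multiple_deviation_succ _ n.+1) multiple_deviation_trunc_log_succ.
by rewrite intS; ring.
Qed.

Section Real.
Variable R : realType.

Lemma dist_intE (z : int) (t : R) : 0 <= t <= 1 ->
  dist_int (z%:~R + t) = Num.min t (1 - t).
Proof.
move=> /andP[t_ge0 t_le1]; apply/eqP; rewrite eq_le; apply/andP; split.
  have lb : has_lbound [set `|z%:~R + t - m%:~R| | m in [set: int]]%classic.
    by exists 0 => _ [m _ <-].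
  rewrite le_min; apply/andP; split; apply: ge_inf => //.
    by exists z => //; rewrite addrC addKr ger0_norm.
  exists (z + 1) => //; rewrite intrD ler0_norm; lra.
apply: lb_le_inf; first by exists `|z%:~R + t - 0%:~R|, 0.
move=> _ [m _ <-]; rewrite ge_min.
have [le_mz|lt_zm] := leP m z.
  have : (m%:~R : R) <= z%:~R by rewrite ler_int.
  by move=> h; apply/orP; left; rewrite ger0_norm; lra.
have : ((z + 1)%:~R : R) <= m%:~R by rewrite ler_int; lia.
rewrite intrD => h.
by apply/orP; right; rewrite ler0_norm; lra.
Qed.

(** Scaling by [d] carries the nearest integer to the nearest multiple of [d]. *)
Lemma dist_int_frac (d m : nat) : (0 < d)%N ->
  dist_int (m%:R / d%:R : R) = (dist_multiple d m)%:R / d%:R.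
Proof.
move=> d_gt0; have dR_gt0 : (0 : R) < d%:R by rewrite ltr0n.
have s_lt := ltn_pmod m d_gt0.
have -> : m%:R / d%:R = (m %/ d)%:Z%:~R + (m %% d)%:R / d%:R :> R.
  by rewrite {1}(divn_eq m d) natrD natrM -pmulrn; field; rewrite gt_eqF.
rewrite dist_intE; last first.
  by rewrite divr_ge0 //= ler_pdivrMr // mul1r ler_nat ltnW.
have -> : 1 - (m %% d)%:R / d%:R = (d - m %% d)%:R / d%:R :> R.
  by rewrite natrB 1?ltnW //; field; rewrite gt_eqF.
by rewrite -minr_pMl ?invr_ge0 ?ltW // /dist_multiple natr_min.
Qed.

Lemma lim_series_finite_support (u : nat -> R) (K : nat) :
  (forall j, (K <= j)%N -> u j = 0) ->
  limn (series u) = \sum_(j < K) u j.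
Proof.
move=> u0; apply: cvg_lim => //; apply: cvg_near_cst.
near=> N; apply/eqP; rewrite /series /=.
have le_KN : (K <= N)%N by near: N; exact: nbhs_infty_ge.
rewrite (big_cat_nat (leq0n K) le_KN) //= big_mkord.
rewrite (_ : \sum_(K <= j < N) u j = 0) ?addr0 // big_nat.
by apply: big1 => j /andP[/u0].
Unshelve. all: by end_near. Qed.

(** For [j < K] the term of index [j] only involves [m / 2 ^ (K - j)], so that
    the factor [2 ^ K * 2 ^- j] exactly clears its denominator. *)
Lemma takagi_dyadic (K m : nat) :
  2 ^+ K * takagi (m%:R / 2 ^+ K) = (multiple_deviation K m)%:R :> R.
Proof.
have two_neq0 (e : nat) : (2 ^+ e : R) != 0 by rewrite expf_neq0 // pnatr_eq0.
rewrite /takagi (@lim_series_finite_support _ K); last first.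
  move=> j le_Kj.
  (* For [j >= K] the argument is an integer, here seen as a fraction over 1. *)
  have -> : 2 ^+ j * (m%:R / 2 ^+ K) = (2 ^ (j - K) * m)%:R / 1%:R :> R.
    by rewrite natrM natrX -{1}(subnK le_Kj) exprD; field.
  by rewrite dist_int_frac // dist_multiple_dvd ?dvd1n // mul0r mulr0.
rewrite mulr_sumr /multiple_deviation natr_sum (reindex_inj rev_ord_inj) /=.
apply: eq_bigr => i _; set j := (K - i.+1)%N.
have K_split : K = (j + i.+1)%N by rewrite /j subnK.
have -> : 2 ^+ j * (m%:R / 2 ^+ K) = m%:R / (2 ^ i.+1)%:R :> R.
  by rewrite natrX {1}K_split exprD; field; rewrite !two_neq0.
rewrite dist_int_frac ?expn_gt0 // natrX {1}K_split exprD.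
by field; rewrite !two_neq0.
Qed.

Lemma floor_log2 (n : nat) : (0 < n)%N ->
  Num.floor (ln (n%:R : R) / ln 2) = (trunc_log 2 n)%:Z.
Proof.
move=> n_gt0; have /andP[le_n lt_n] := trunc_log_bounds (isT : 1 < 2)%N n_gt0.
have ln2_gt0 : 0 < ln (2 : R) by rewrite ln_gt0 // ltr1n.
have nR_gt0 : (0 : R) < n%:R by rewrite ltr0n.
have lnX (e : nat) : e%:R * ln (2 : R) = ln ((2 ^ e)%:R).
  by rewrite natrX lnXn // mulr_natl.
apply: floor_def; rewrite -[_ + 1]/((_ + 1)%N%:Z) addn1 -!pmulrn.
by rewrite ler_pdivlMr // ltr_pdivrMr // !lnX ler_ln ?ltr_ln ?posrE ?ltr0n ?expn_gt0 //
  ler_nat ltr_nat le_n.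
Qed.

End Real.

Theorem theorem3p3 (R : realType) (n : nat) (n_gt0 : (0 < n)%N) :
  let k : int := Num.floor (ln (n%:R : R) / ln 2) in
  (A n)%:~R = n%:R - 2 ^ k * takagi ((n.+1)%:R / 2 ^ k - 1) :> R.
Proof.
move=> k; rewrite /k floor_log2 // -exprnP; set K := trunc_log 2 n.
have le_n : (2 ^ K <= n.+1)%N by rewrite leqW // trunc_logP.
have -> : (n.+1)%:R / 2 ^+ K - 1 = (n.+1 - 2 ^ K)%:R / 2 ^+ K :> R.
  by rewrite natrB // natrX mulrBl divff // expf_neq0 // pnatr_eq0.
rewrite takagi_dyadic A_multiple_deviation -/K intrB -!pmulrn.
(* [n.+1] and [n.+1 - 2 ^ K] agree modulo every [2 ^ i.+1] with [i < K]. *)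
congr (_ - _%:R); apply: eq_bigr => i _; apply: dist_multiple_mod.
rewrite -{1}(subnK le_n) -modnDmr.
by have /eqP -> : (2 ^ i.+1 %| 2 ^ K)%N; rewrite ?dvdn_exp2l // addn0.
Qed.
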